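(* The word $$s_{3,2}=ab^2aba^3b^2a^2babab^2a^2b^3aba^2ba^2b^2a$$ of length $33$ over $\{a,b\}$ is not $3$-collapsing; that is, there exists a $3$-compressible automaton with input alphabet $\{a,b\}$ for which $s_{3,2}$ is not $3$-compressing.
   Context: A (semi)automaton is a triple $\mathcal A=(Q,\Sigma,\delta)$ with $Q$ a finite set of states, $\Sigma$ an alphabet and $\delta:Q\times\Sigma\to Q$ a total function. Words act on states from the right, letter by letter from left to right: $qw$ is the state reached from $q$ by reading $w$, and $Qw=\{qw: q\in Q\}$. The deficiency of $w\in\Sigma^+$ for $\mathcal A$ is $|Q|-|Qw|$. The word $w$ is $3$-compressing for $\mathcal A$ if its deficiency is at least $3$; $\mathcal A$ is $3$-compressible if some word is $3$-compressing for it. A word $w\in\Sigma^+$ is $3$-collapsing if it is $3$-compressing for every $3$-compressible automaton with input alphabet $\Sigma$. *)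

(* Defs.v *)
From mathcomp Require Import all_boot.

Set Implicit Arguments.
Unset Strict Implicit.
Unset Printing Implicit Defensive.

Record automaton (Sigma : Type) := Automaton {
  state : finType;
  trans : state -> Sigma -> state
}.

Section Automata.

Variable Sigma : Type.
Implicit Types (A : automaton Sigma) (w : seq Sigma) (k : nat).

(* Words act from the right: the leftmost letter is read first. *)
Definition run A (q : state A) w : state A := foldl (@trans Sigma A) q w.

Definition run_image A w : {set state A} :=
  [set run q w | q in [set: state A]].

(* The truncated subtraction is exact, since #|run_image A w| <= #|state A|. *)
Definition deficiency A w : nat := #|state A| - #|run_image A w|.

Definition compressing k A w : Prop := k <= deficiency A w.

Definition compressible k A : Prop :=
  exists w, w <> [::] /\ compressing k A w.

Definition collapsing k w : Prop :=
  w <> [::] /\ forall A, compressible k A -> compressing k A w.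

End Automata.

Inductive letter := la | lb.

(* a b^2 a b a^3 b^2 a^2 b a b a b^2 a^2 b^3 a b a^2 b a^2 b^2 a *)
Definition s32 : seq letter :=
  flatten
    [:: nseq 1 la; nseq 2 lb; nseq 1 la; nseq 1 lb; nseq 3 la; nseq 2 lb;
        nseq 2 la; nseq 1 lb; nseq 1 la; nseq 1 lb; nseq 1 la; nseq 2 lb;
        nseq 2 la; nseq 3 lb; nseq 1 la; nseq 1 lb; nseq 2 la; nseq 1 lb;
        nseq 2 la; nseq 2 lb; nseq 1 la].

(* Main.v *)
Require Import Defs.
From mathcomp Require Import all_boot.

(** Take five states, let a be the cyclic shift q -> q + 1 mod 5 and let b be
    0, 1 -> 3, 2 -> 4, 3 -> 1, 4 -> 2.  Follow the set M of states missing from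
    the image.  Reading a shifts M; reading b turns M into {0} together with
    the b-images of M \ {0, 1}, plus 3 when M contains both 0 and 1.  Thus M
    grows from two to three elements only when b is read while M is a pair
    inside {2, 3, 4}.

    Along s32 this never happens: each time b is read while M is a pair, M
    meets {0, 1}.  At the end M = {1, 3}, so the three states 0, 2 and 4
    survive ([lt2_card_image_s32]).  But after the factors b, a^3, b, a^2 of
    b a^3 b a^2 b the set M is {0}, {3}, {0, 1}, {2, 3} in turn, and the last
    b produces {0, 1, 4}, so the automaton is 3-compressible
    ([short_word_image]). *)

(** Unlike [inord], this has a value that computes. *)
Definition mod5 (n : nat) : 'I_5 := Ordinal (ltn_pmod n (isT : 0 < 5)).

Definition step (q : 'I_5) (x : letter) : 'I_5 :=
  if x is la then mod5 q.+1 else mod5 (nth 0 [:: 3; 3; 4; 1; 2] q).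

Definition cycle5 : automaton letter := Automaton step.

Definition short_word : seq letter := [:: lb; la; la; la; lb; la; la; lb].

Lemma short_word_image : run_image cycle5 short_word \subset [set mod5 2; mod5 3].
Proof.
apply/subsetP=> _ /imsetP[q _ ->]; rewrite !inE -!val_eqE.
by case: q => [[|[|[|[|[|q]]]]] lt_q5] //; vm_compute.
Qed.

Lemma compressible_cycle5 : compressible 3 cycle5.
Proof.
exists short_word; split=> //; rewrite /compressing /deficiency card_ord.
have := leq_sub2l 5 (subset_leq_card short_word_image).
by rewrite cards2; apply: leq_trans.
Qed.

(** The states 0, 1 and 2 are sent to 4, 0 and 2. *)
Lemma lt2_card_image_s32 : 2 < #|run_image cycle5 s32|.
Proof.
pose f (q : 'I_5) : state cycle5 := run (A := cycle5) q s32.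
apply/card_gt2P; exists (f (mod5 0)), (f (mod5 1)), (f (mod5 2)).
by split; split; rewrite ?imset_f ?inE // -val_eqE; vm_compute.
Qed.

Lemma not_compressing_cycle5_s32 : ~ compressing 3 cycle5 s32.
Proof.
rewrite /compressing /deficiency card_ord => deficiency_ge3.
by have := leq_trans deficiency_ge3 (leq_sub2l 5 lt2_card_image_s32).
Qed.

Theorem mainTheorem3 :
  size s32 = 33 /\
  ~ collapsing 3 s32 /\
  (exists A : automaton letter, compressible 3 A /\ ~ compressing 3 A s32).
Proof.
split=> //; split.
  by case=> _ /(_ _ compressible_cycle5) /not_compressing_cycle5_s32.
by exists cycle5; split; [exact: compressible_cycle5
                         | exact: not_compressing_cycle5_s32].
Qed.
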